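(* Let $r$ and $s$ be positive integers with $r \geq s \geq 2$. If $r > 3s - 3$, then $f(s,r,\{\infty\}\cup\mathbb{Z}) = 3s + 3r - 4$.
   Context: For integers $a\le b$, $[a,b]=\{n\in\mathbb{N} : a\le n\le b\}$. For a finite set $X\subseteq\mathbb{N}$, $\mathrm{diam}(X)=\max(X)-\min(X)$. Let $\infty$ denote an additional color not in $\mathbb{Z}$. For a coloring $\Delta:[1,n]\to\{\infty\}\cup\mathbb{Z}$, a set $Y$ is $\infty$-monochromatic if $\Delta(y)=\infty$ for all $y\in Y$, and is zero-sum mod $m$ if $\Delta(Y)\subseteq\mathbb{Z}$ and $\sum_{y\in Y}\Delta(y)\equiv 0\pmod m$. $f(s,r,\{\infty\}\cup\mathbb{Z})$ denotes the smallest positive integer $n$ such that for every coloring $\Delta:[1,n]\to\{\infty\}\cup\mathbb{Z}$ there exist subsets $S_1,S_2\subseteq[1,n]$ with: (a) $S_1$ is either $\infty$-monochromatic or zero-sum mod $s$, and $S_2$ is either $\infty$-monochromatic or zero-sum mod $r$; (b) $|S_1|=s$, $|S_2|=r$; (c) $\max(S_1)<\min(S_2)$; (d) $\mathrm{diam}(S_1)\le\mathrm{diam}(S_2)$. *)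

(* Defs.v *)
From mathcomp Require Export all_boot all_order all_algebra finmap.

Set Implicit Arguments.
Unset Strict Implicit.
Unset Printing Implicit Defensive.

Local Open Scope fset_scope.

(* A coloring with values in {oo} u Z is [D : nat -> option int], where [None]
   is the color oo; only the values of [D] on [1, n] matter below. *)

Definition fset_max (X : {fset nat}) : nat := \max_(x <- X) x.

(* [fset_max X] is only the starting value of the iteration; it is neutral as
   soon as [X] is nonempty. *)
Definition fset_min (X : {fset nat}) : nat :=
  \big[minn/fset_max X]_(x <- X) x.

Definition diam (X : {fset nat}) : nat := fset_max X - fset_min X.

Definition infty_monochromatic (D : nat -> option int) (Y : {fset nat}) : Prop :=
  forall y, y \in Y -> D y = None.

Definition zero_sum_mod (m : nat) (D : nat -> option int) (Y : {fset nat}) :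
    Prop :=
  (forall y, y \in Y -> D y <> None) /\
  ((\sum_(y <- Y) odflt 0%R (D y))%R = 0%R %[mod m%:Z])%Z.

Definition in_interval (a b : nat) (X : {fset nat}) : Prop :=
  forall x, x \in X -> a <= x <= b.

Definition forcing (s r n : nat) : Prop :=
  forall D : nat -> option int,
  exists S1 S2 : {fset nat},
    [/\ in_interval 1 n S1 /\ in_interval 1 n S2,
        (infty_monochromatic D S1 \/ zero_sum_mod s D S1) /\
        (infty_monochromatic D S2 \/ zero_sum_mod r D S2),
        #|` S1| = s /\ #|` S2| = r,
        fset_max S1 < fset_min S2
      & diam S1 <= diam S2].

(* [is_f s r n] reads "f(s, r, {oo} u Z) = n"; it includes the existence of the
   minimum. *)
Definition is_f (s r n : nat) : Prop :=
  [/\ 0 < n, forcing s r n & forall k, 0 < k -> forcing s r k -> n <= k].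

(* Main.v *)
Require Import Defs.
From mathcomp Require Import finfield zify.

(** By the Erdos-Ginzburg-Ziv theorem, among [3 m - 2] points there are either
    [m] points of color oo or [2 m - 1] integer colored points, and the latter
    contain a zero-sum [m]-subset. Hence the first [3 s - 2] points contain a
    suitable [S1], of diameter at most [3 s - 3], and the next [3 r - 2] points
    contain a suitable [S2], of diameter at least [r - 1 >= 3 s - 3].
    Conversely, [m - 1] points of each of the colors oo, 0, 1 contain no
    suitable [m]-set: color the first [3 s - 3] and the last [3 r - 3] of
    [3 s + 3 r - 5] points this way. *)

Set Implicit Arguments.
Unset Strict Implicit.
Unset Printing Implicit Defensive.

Import GRing.Theory.
Local Open Scope fset_scope.

(** * Erdos-Ginzburg-Ziv for a prime modulus *)

Lemma prime_dvd_fact p n : prime p -> (p %| n`!) = (p <= n).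
Proof.
move=> p_pr; elim: n => [|n IH].
  by rewrite fact0 dvdn1 leqn0; case: p p_pr => [|[]].
rewrite factS Euclid_dvdM // IH [RHS]leq_eqVlt ltnS.
apply/orP/orP => -[H|H]; [|by right|by left; rewrite (eqP H)|by right].
by have := dvdn_leq (ltn0Sn n) H; rewrite leq_eqVlt ltnS => /orP.
Qed.

(** The prime [p] divides n! but neither k! nor (n - k)!. *)
Lemma prime_dvd_bin_mid p n k : prime p -> k < p -> n - k < p -> p <= n ->
  p %| 'C(n, k).
Proof.
move=> p_pr kp nkp pn; have kn : k <= n by lia.
have : p %| n`! by rewrite prime_dvd_fact.
rewrite -(bin_fact kn) !Euclid_dvdM // !prime_dvd_fact // => /or3P[] //; lia.
Qed.

Lemma card_supersets (T : finType) (J : {set T}) k : k <= #|T| ->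
  #|[set I : {set T} | (J \subset I) && (#|I| == k)]|
  = 'C(#|T| - #|J|, #|T| - k).
Proof.
move=> kT; rewrite -(card_imset _ (can_inj (@setCK T))).
have -> : (#|T| - #|J|)%N = #|~: J| by rewrite [RHS]cardsCs setCK.
rewrite -cards_draws; congr (#|pred_of_set _|).
apply/setP => I; apply/imsetP/idP => [[I' + ->]|].
  rewrite !inE setCS => /andP[-> /eqP I'k] /=.
  by rewrite cardsCs setCK I'k.
rewrite inE => /andP[IJ /eqP Ik]; exists (~: I); last by rewrite setCK.
rewrite inE -setCS setCK IJ /= cardsCs setCK Ik; apply/eqP; lia.
Qed.

Section PrimeCase.
Local Open Scope ring_scope.

(* Expanding the power, the monomial indexed by [f] occurs once for every
   [p]-subset containing the at most [p - 1] points of its support, hence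
   [0 mod p] times. *)
Lemma sum_power_subsets p (T : finType) (a : T -> 'F_p) :
  prime p -> #|T| = (2 * p - 1)%N ->
  \sum_(I : {set T} | #|I| == p) (\sum_(i in I) a i) ^+ p.-1 = 0.
Proof.
move=> p_pr cT; have p_gt1 := prime_gt1 p_pr.
transitivity (\sum_(I : {set T} | #|I| == p)
   \sum_(f : {ffun 'I_p.-1 -> T} | [set f k | k : 'I_p.-1] \subset I)
      \prod_k a (f k)).
  apply: eq_bigr => I _.
  have -> : (\sum_(i in I) a i) ^+ p.-1
      = \prod_(k < p.-1) \sum_(i in I) a i by rewrite prodr_const card_ord.
  rewrite bigA_distr_big; apply: eq_bigl => f.
  apply/ffun_onP/subsetP => [fI x /imsetP[k _ ->] //|fI k].
  exact/fI/imset_f.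
rewrite (exchange_big_dep predT) //= big1 // => f _.
set J := [set f k | k : 'I_p.-1].
rewrite (eq_bigl (mem [set I : {set T} | (J \subset I) && (#|I| == p)]));
  last by move=> I; rewrite !inE andbC.
rewrite sumr_const card_supersets; last by lia.
have cJ : (#|J| <= p.-1)%N.
  by rewrite (leq_trans (leq_imset_card _ _)) // card_ord.
have J_gt0 : (0 < #|J|)%N.
  have p1_gt0 : (0 < p.-1)%N by lia.
  by apply/card_gt0P; exists (f (Ordinal p1_gt0)); apply: imset_f.
(* The bounds 1 <= |J| <= p - 1 put the upper index 2p - 1 - |J| in [p, 2p - 2]; the lower index is
   p - 1, and their difference p - |J| is below p. *)
have : (p %| 'C(#|T| - #|J|, #|T| - p))%N by apply: prime_dvd_bin_mid; lia.
case/dvdnP => q ->.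
by rewrite mulrnA -mulr_natr pchar_Fp_0 // mulr0.
Qed.

(** If no p-subset had sum 0, Fermat would make every term of [sum_power_subsets] equal to 1, so [p]
    would divide the binomial coefficient of 2p - 1 over p. *)
Lemma EGZ_prime_Fp p (T : finType) (a : T -> 'F_p) :
  prime p -> #|T| = (2 * p - 1)%N ->
  exists2 I : {set T}, #|I| = p & \sum_(i in I) a i = 0.
Proof.
move=> p_pr cT; have p_gt1 := prime_gt1 p_pr.
case: (pickP [pred I : {set T} | (#|I| == p) && (\sum_(i in I) a i == 0)]).
  by move=> I /andP[/eqP cI /eqP sI]; exists I.
move=> no_zero; have := sum_power_subsets a p_pr cT.
rewrite (eq_bigr (fun=> 1)); last first.
  move=> I cI; have := no_zero I; rewrite /= cI /= => /negbT sI.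
  apply: (mulfI sI); rewrite mulr1 -exprS prednK; last by lia.
  by have := expf_card (\sum_(i in I) a i); rewrite card_Fp.
rewrite sumr_const.
have -> : #|[pred I : {set T} | #|I| == p]| = 'C(#|T|, p).
  by rewrite -cardsT -cards_draws; apply: eq_card => I; rewrite !inE subsetT.
move/eqP; rewrite -(dvdn_pcharf (pchar_Fp p_pr)) => dvd_bin.
(* This falling factorial is (2p - 1) ... (p + 1): all its factors lie strictly between p and 2p. *)
have : (p %| #|T| ^_ p.-1)%N.
  rewrite -bin_ffact -bin_sub; last by lia.
  by rewrite (_ : #|T| - p.-1 = p)%N ?dvdn_mulr //; lia.
rewrite ffact_prod Euclid_dvd_prod // big_has => /hasP[i _ /dvdnP[q Tq]].
have := ltn_ord i; have : (q < 2)%N by nia.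
by case: q Tq => [|[]] //; lia.
Qed.
End PrimeCase.

(** * Erdos-Ginzburg-Ziv for an arbitrary modulus *)

Lemma fsubset_of_card (K : choiceType) (A : {fset K}) k : k <= #|` A| ->
  exists2 B : {fset K}, B `<=` A & #|` B| = k.
Proof.
move=> kA; exists [fset x in take k A].
  by apply/fsubsetP => x; rewrite !inE => /mem_take.
by rewrite card_fseq undup_id ?take_uniq // size_takel.
Qed.

(** The type [K] varies because [EGZ_mul] applies the property both to points and to indices of
    blocks. *)
Definition EGZ_property (m : nat) : Prop :=
  forall (K : choiceType) (A : {fset K}) (a : K -> int),
  2 * m - 1 <= #|` A| ->
  exists B : {fset K},
    [/\ B `<=` A, #|` B| = m & (m %| (\sum_(x <- B) a x)%R)%Z].

Lemma EGZ_prime p : prime p -> EGZ_property p.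
Proof.
move=> p_pr K A0 a /fsubset_of_card[A AA0 cA].
have [|I cI sI] := @EGZ_prime_Fp p A (fun x => (a (val x))%:~R%R) p_pr.
  by rewrite -cardfE.
exists [fset val x | x in I]; split.
- apply: fsubset_trans AA0; apply/fsubsetP => x /imfsetP[y _ ->].
  exact: valP.
- by rewrite card_imfset //= -?cardE ?cI //; exact: val_inj.
- rewrite big_imfset /=; last by move=> x y _ _; exact: val_inj.
  rewrite (dvdz_pcharf (pchar_Fp p_pr)) rmorph_sum /=.
  by rewrite big_enum; exact/eqP.
Qed.

(** Greedy choice: while k >= 1 there are at least 2p - 1 points, and removing one zero-sum block
    leaves at least kp - 1. *)
Lemma EGZ_disjoint p k (K : choiceType) (A : {fset K}) (a : K -> int) :
  0 < p -> EGZ_property p -> k.+1 * p - 1 <= #|` A| ->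
  exists B : nat -> {fset K},
    [/\ forall i, i < k -> B i `<=` A, forall i, i < k -> #|` B i| = p,
        forall i, i < k -> (p %| (\sum_(x <- B i) a x)%R)%Z
      & forall i j, i < k -> j < k -> i != j -> [disjoint B i & B j]].
Proof.
move=> p_gt0 egz; elim: k A => [|k IH] A cA; first by exists (fun=> fset0).
have [|C [CA cC sC]] := egz K A a; first by nia.
have [|B [BA cB sB dB]] := IH (A `\` C).
  by rewrite cardfsDS // cC; nia.
have dCB i : i < k -> [disjoint C & B i].
  by move=> /BA /fsubsetDP[_]; rewrite fdisjoint_sym.
exists (fun i => if i is j.+1 then B j else C); split.
- case=> [//|i] ik; apply: fsubset_trans (BA i ik) (fsubsetDl _ _).
- by case=> [//|i]; exact: cB.
- by case=> [//|i]; exact: sB.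
- case=> [|i] [|j] //= ik jk ij; first exact: dCB.
    by rewrite fdisjoint_sym; exact: dCB.
  exact: dB.
Qed.

(** From 2pn - 1 points one gets 2n - 1 disjoint p-blocks with sums divisible by p. Among the sums
    divided by p, some n add up to a multiple of n; the union of these blocks is the required
    set. *)
Lemma EGZ_mul p n : 0 < p -> 0 < n ->
  EGZ_property p -> EGZ_property n -> EGZ_property (p * n).
Proof.
move=> p_gt0 n_gt0 egzp egzn K A a cA.
have [|B [BA cB sB dB]] := @EGZ_disjoint p (2 * n - 1) K A a p_gt0 egzp.
  by nia.
pose b i := ((\sum_(x <- B i) a x)%R %/ p)%Z.
have [|C [CI cC sC]] := egzn nat [fset x in iota 0 (2 * n - 1)] b.
  by rewrite card_fseq undup_id ?iota_uniq // size_iota.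
have ltC i : i \in C -> i < 2 * n - 1.
  by move=> /(fsubsetP CI); rewrite !inE mem_iota.
have dC i j : i \in C -> j \in C -> i != j -> [disjoint B i & B j].
  by move=> /ltC ? /ltC ?; exact: dB.
exists (\bigcup_(i <- C) B i); split.
- by apply/bigfcupsP => i iC _; exact/BA/ltC.
- rewrite -sum1_size partition_disjoint_bigfcup //=.
  rewrite (eq_big_seq (fun=> p)) => [|i /ltC /cB <-]; last by rewrite sum1_size.
  by rewrite big_const_seq count_predT iter_addn_0 cC.
- rewrite partition_disjoint_bigfcup //=.
  rewrite (eq_big_seq (fun i => (b i * p%:Z)%R)); last first.
    by move=> i /ltC /sB; rewrite /b => /divzK ->.
  by rewrite -mulr_suml PoszM mulrC dvdz_mul.
Qed.

Theorem Erdos_Ginzburg_Ziv m : 0 < m -> EGZ_property m.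
Proof.
elim/ltn_ind: m => m IH m_gt0.
have [m_le1|m_gt1] := leqP m 1.
  have -> : m = 1 by lia.
  by move=> K A a /fsubset_of_card[B BA cB]; exists B; split=> //.
have p_pr := pdiv_prime m_gt1; have p_gt1 := prime_gt1 p_pr.
have mE : m = pdiv m * (m %/ pdiv m) by rewrite mulnC divnK // pdiv_dvd.
have q_gt0 : 0 < m %/ pdiv m by rewrite divn_gt0 ?pdiv_gt0 // pdiv_leq.
rewrite mE; apply: EGZ_mul => //.
  exact: EGZ_prime.
by apply: IH => //; rewrite ltn_Pdiv.
Qed.

(** * Maximum, minimum and diameter *)

Lemma leq_fset_max (X : {fset nat}) x : x \in X -> x <= fset_max X.
Proof. by move=> xX; rewrite /fset_max (big_rem x xX) leq_maxl. Qed.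

Lemma fset_max_leq (X : {fset nat}) b :
  (forall x, x \in X -> x <= b) -> fset_max X <= b.
Proof.
move=> Xb; rewrite /fset_max big_seq.
by elim/big_ind: _ => // x y xb yb; rewrite geq_max xb.
Qed.

Lemma fset_min_leq (X : {fset nat}) x : x \in X -> fset_min X <= x.
Proof.
rewrite -[x \in X]/(x \in enum_fset X) /fset_min.
(* The starting value is generalized, since it must stay fixed while the list shrinks. *)
move: (fset_max X) => d; elim: (enum_fset X) => [//|y t IH].
rewrite inE big_cons => /predU1P[->|xt]; first exact: geq_minl.
exact: leq_trans (geq_minr _ _) (IH xt).
Qed.

Lemma leq_fset_min (X : {fset nat}) a : X != fset0 ->
  (forall x, x \in X -> a <= x) -> a <= fset_min X.
Proof.
move=> /fset0Pn[x0 x0X] Xa; rewrite /fset_min big_seq.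
(* The starting value [fset_max X] is at least [a] because [X] has an element. *)
elim/big_ind: _ => //; first exact: leq_trans (Xa _ x0X) (leq_fset_max x0X).
by move=> x y ax ay; rewrite leq_min ax.
Qed.

Lemma card_fset_interval (X : {fset nat}) a b :
  (forall x, x \in X -> a <= x < b) -> #|` X| <= b - a.
Proof.
move=> Xab; rewrite -(size_iota a (b - a)).
apply: uniq_leq_size (fset_uniq X) _ => x /Xab; rewrite mem_iota; lia.
Qed.

Lemma leq_card_diam (X : {fset nat}) : #|` X| <= (diam X).+1.
Proof.
have := @card_fset_interval X (fset_min X) (fset_max X).+1.
rewrite /diam => /(_ _)/leq_trans; apply; last by lia.
by move=> x xX; rewrite ltnS fset_min_leq // leq_fset_max.
Qed.

Lemma diam_leq (X : {fset nat}) a b : X != fset0 -> in_interval a b X ->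
  diam X <= b - a.
Proof.
move=> X0 Xab.
have := @leq_fset_min X a X0 (fun x xX => proj1 (andP (Xab x xX))).
have := @fset_max_leq X b (fun x xX => proj2 (andP (Xab x xX))).
rewrite /diam; lia.
Qed.

(** * Good sets: existence and avoidance *)

Definition good_set (m : nat) (D : nat -> option int) (Y : {fset nat}) : Prop :=
  infty_monochromatic D Y \/ zero_sum_mod m D Y.

Lemma good_set_exists m c (D : nat -> option int) : 0 < m ->
  exists Y : {fset nat},
    [/\ in_interval c.+1 (c + (3 * m - 2)) Y, good_set m D Y & #|` Y| = m].
Proof.
move=> m_gt0; pose A := [fset x in iota c.+1 (3 * m - 2)].
have cA : #|` A| = 3 * m - 2 by rewrite card_fseq undup_id ?iota_uniq ?size_iota.
have AP x : x \in A -> c.+1 <= x <= c + (3 * m - 2).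
  by rewrite !inE mem_iota; lia.
pose N := [fset x in A | D x == None].
have NA : N `<=` A by apply/fsubsetP => x; rewrite !inE => /andP[].
have [mN|Nm] := leqP m #|` N|.
  have [Y YN cY] := fsubset_of_card mN; exists Y; split=> //.
    by move=> x xY; exact/AP/(fsubsetP NA)/(fsubsetP YN).
  by left=> y /(fsubsetP YN); rewrite !inE => /andP[_ /eqP].
have [|Y [YZ cY sY]] :=
  @Erdos_Ginzburg_Ziv m m_gt0 _ (A `\` N) (fun x => odflt 0%R (D x)).
  by rewrite cardfsDS // cA; lia.
exists Y; split=> //.
  by move=> x /(fsubsetP YZ); rewrite inE => /andP[_ /AP].
right; split.
  move=> y /(fsubsetP YZ); rewrite inE => /andP[yN yA] Dy.
  by case/negP: yN; move: yA; rewrite !inE Dy eqxx andbT.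
by apply/eqP; rewrite eqz_mod_dvd subr0.
Qed.

(* [3 (m - 1)] consecutive points split into blocks of [m - 1] points of colors
   [oo], [0] and [1]. *)
Definition three_blocks (m x : nat) : option int :=
  if x < m.-1 then None else if x < 2 * m.-1 then Some 0%R else Some 1%R.

(** Color oo has too few points to fill [Y]. Otherwise the sum is the number of points of color 1 in
    [Y], which is at most m - 1, and at least 1 because color 0 also has only m - 1 points. *)
Lemma three_blocks_not_good m c (D : nat -> option int) (Y : {fset nat}) :
  1 < m -> #|` Y| = m ->
  (forall y, y \in Y -> c <= y < c + 3 * m.-1 /\ D y = three_blocks m (y - c)) ->
  ~ good_set m D Y.
Proof.
move=> m_gt1 cY DY [Yinf|[Yfin Ysum]].
  have : #|` Y| <= c + m.-1 - c; last by lia.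
  apply: card_fset_interval => y yY; have [yc Dy] := DY y yY.
  move: (Yinf y yY); rewrite Dy /three_blocks.
  by case: (ltnP (y - c) m.-1) => [? _|_]; [lia | case: ifP].
pose Y1 := [fset y in Y | c + 2 * m.-1 <= y].
have Y1Y : Y1 `<=` Y by apply/fsubsetP => x; rewrite !inE => /andP[].
have low y : y \in Y -> c + m.-1 <= y.
  move=> yY; have [yc Dy] := DY y yY.
  move: (Yfin y yY); rewrite Dy /three_blocks.
  by case: (ltnP (y - c) m.-1) => // ? _; lia.
have cY1 : #|` Y1| <= c + 3 * m.-1 - (c + 2 * m.-1).
  apply: card_fset_interval => y; rewrite !inE => /andP[yY ->].
  by have [/andP[_ ->]] := DY y yY.
have cY0 : #|` Y `\` Y1| <= c + 2 * m.-1 - (c + m.-1).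
  apply: card_fset_interval => y; rewrite !inE => /andP[+ yY].
  by rewrite yY /= -ltnNge => ->; rewrite low.
rewrite cardfsDS // cY in cY0.
have sumE : (\sum_(y <- Y) odflt 0 (D y))%R = Posz #|` Y1|.
  rewrite (eq_big_seq (fun y => if c + 2 * m.-1 <= y then 1%R else 0%R)).
    by rewrite -big_mkcond /= big_fset_condE big_const_seq count_predT
      iter_addr_0 natz.
  move=> y yY; have [yc ->] := DY y yY; have := low y yY.
  rewrite /three_blocks; case: ltnP; first by lia.
  by case: ltnP => ? ? ?; case: leqP => //; lia.
move/eqP: Ysum; rewrite sumE eqz_mod_dvd subr0 dvdzE /= => /dvdn_leq mY1.
have : m <= #|` Y1| by apply: mY1; move: #|` Y1| cY1 cY0 => k; lia.
lia.
Qed.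

(** * The two bounds on f *)

Lemma forcing_monotone s r k n : k <= n -> forcing s r k -> forcing s r n.
Proof.
move=> kn fk D; have [S1 [S2 [[i1 i2] ? ? ? ?]]] := fk D.
exists S1, S2; split=> //; split=> x.
  by move=> /i1/andP[-> /leq_trans->].
by move=> /i2/andP[-> /leq_trans->].
Qed.

Lemma forcing_upper r s : 2 <= s -> 3 * s - 3 < r ->
  forcing s r (3 * s + 3 * r - 4).
Proof.
move=> hs hr D.
have [|S1 [i1 g1 c1]] := @good_set_exists s 0 D; first by lia.
have [|S2 [i2 g2 c2]] := @good_set_exists r (3 * s - 2) D; first by lia.
have S1n : S1 != fset0 by rewrite -cardfs_gt0; lia.
have S2n : S2 != fset0 by rewrite -cardfs_gt0; lia.
exists S1, S2; split=> //.
- by split=> x => [/i1|/i2]; lia.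
- have : fset_max S1 <= 3 * s - 2 by apply: fset_max_leq => x /i1; lia.
  have : 3 * s - 1 <= fset_min S2 by apply: leq_fset_min => // x /i2; lia.
  lia.
- have := diam_leq S1n i1; have := leq_card_diam S2; lia.
Qed.

Lemma not_forcing_lower r s : 2 <= s -> 2 <= r ->
  ~ forcing s r (3 * s + 3 * r - 5).
Proof.
move=> hs hr forc.
(* The point [3 s - 2] between the two configurations can have any color. *)
pose D x := if x < 3 * s - 2 then three_blocks s (x - 1)
            else three_blocks r (x - (3 * s - 1)).
have [S1 [S2 [[i1 i2] [g1 g2] [c1 c2] lt12 _]]] := forc D.
(* Either [S1] lies inside the first configuration, or its maximum is at least 3s - 2 and [S2] lies
   inside the second one, which starts at 3s - 1. *)
have [S1s|] := leqP (fset_max S1) (3 * s - 3).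
  apply: (@three_blocks_not_good s 1 D S1) g1 => // y yS.
  have := leq_fset_max yS; have := i1 y yS => ? ?; split; first by lia.
  by rewrite /D; case: ltnP => //; lia.
move=> S1s; apply: (@three_blocks_not_good r (3 * s - 1) D S2) g2 => // y yS.
have := fset_min_leq yS; have := i2 y yS => ? ?; split; first by lia.
by rewrite /D; case: ltnP => //; lia.
Qed.

Theorem theorem4p10 (r s : nat) (hs : 2 <= s) (hrs : s <= r)
  (hr : 3 * s - 3 < r) :
  is_f s r (3 * s + 3 * r - 4).
Proof.
split; [lia | exact: forcing_upper |] => k _ fk.
rewrite leqNgt; apply/negP => k_lt.
(* By monotonicity, a smaller forcing length would make 3s + 3r - 5 forcing too. *)
apply: (@not_forcing_lower r s) => //; first by lia.
by apply: forcing_monotone fk; lia.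
Qed.
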